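(* The on-line choice number of $K_{4*3}$ satisfies $\mathrm{ch}^{OL}(K_{4*3})\ge 5$.
   Context: $K_{4*3}$ is the complete $3$-partite graph with $4$ vertices in each part. For a graph $G=(V,E)$ and $f:V\to\mathbb N$, the paintability game is played by Alice and Bob: with $V_1=V$, in round $i$ Alice selects a nonempty set $A_i\subseteq V_i$, Bob selects an independent set $B_i\subseteq A_i$, and $V_{i+1}=V_i\setminus B_i$; play continues until all vertices are removed. $G$ is on-line $f$-choosable if Bob has a strategy ensuring that every vertex $v$ lies in at most $f(v)$ of the sets $A_i$ (i.e., every vertex is removed before being presented $f(v)+1$ times), and on-line $k$-choosable if this holds for the constant function $f\equiv k$. The on-line choice number $\mathrm{ch}^{OL}(G)$ is the least $k$ such that $G$ is on-line $k$-choosable. *)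

(* Defs.v *)
From HB Require Import structures.
From mathcomp Require Import all_boot.
From mathcomp Require Import boolp.

Set Implicit Arguments.
Unset Strict Implicit.
Unset Printing Implicit Defensive.

Record sgraph := SGraph {
  vertex :> finType;
  adj : rel vertex;
  adj_sym : symmetric adj;
  adj_irrefl : irreflexive adj }.

Definition independent (G : sgraph) (B : {set G}) : Prop :=
  {in B &, forall x y, ~~ adj x y}.

Section Game.
Variable G : sgraph.

(* Histories list Alice's moves with the most recent one first.  A strategy   *)
(* of Bob maps the history A_i :: ... :: A_1 to his answer B_i in round i;    *)
(* his earlier answers are determined by the strategy and the shorter         *)
(* histories.                                                                 *)
Definition strategy := seq {set G} -> {set G}.

(* The set V_{i+1} left after the rounds listed in h. *)
Fixpoint remaining (s : strategy) (h : seq {set G}) : {set G} :=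
  if h is _ :: h' then remaining s h' :\: s h else [set: G].

(* h is a sequence of moves that Alice can play against s. *)
Fixpoint legal (s : strategy) (h : seq {set G}) : bool :=
  if h is A :: h' then [&& legal s h', A != set0 & A \subset remaining s h']
  else true.

Definition admissible (s : strategy) : Prop :=
  forall A h, legal s (A :: h) ->
    s (A :: h) \subset A /\ independent (s (A :: h)).

Definition presented (h : seq {set G}) (v : G) : nat :=
  count (fun A : {set G} => v \in A) h.

(* It is enough to look at finite initial parts of a play: the bound for all  *)
(* of them gives the bound for the whole play, and it forces the play to end, *)
(* which by legality happens only when no vertex remains.                     *)
Definition online_f_choosable (f : G -> nat) : Prop :=
  exists s : strategy,
    admissible s /\ forall h, legal s h -> forall v, presented h v <= f v.

Definition online_choosable (k : nat) : Prop := online_f_choosable (fun=> k).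

Lemma online_choosable_card : online_choosable #|G|.
Proof.
pose s : strategy := fun h =>
  if h is A :: _ then (if [pick x in A] is Some x then [set x] else set0)
  else set0.
have sP A h : A != set0 -> exists2 x, x \in A & s (A :: h) = [set x].
  move=> /set0Pn [y yA]; rewrite /s; case: pickP => [x xA|/(_ y)].
    by exists x.
  by rewrite yA.
clearbody s; exists s; split=> [A h /= /and3P[_ /(sP _ h) [x xA ->] _]|].
  split; first by rewrite sub1set.
  by move=> y z; rewrite !inE => /eqP-> /eqP->; rewrite adj_irrefl.
suff inv h : legal s h -> forall v, presented h v + #|remaining s h| <= #|G|.
  by move=> h lh v; apply: leq_trans (inv h lh v); apply: leq_addr.
elim: h => [_ v|A h IH /= /and3P[lh /(sP _ h) [x xA sE] sub] v].
  by rewrite /= cardsT.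
apply: leq_trans (IH lh v).
rewrite /= sE.
rewrite [#|remaining s h|](cardsD1 x) (subsetP sub _ xA).
by rewrite /presented /= addnA leq_add2r addnC leq_add2l; case: (v \in A).
Qed.

Lemma online_choosable_ex : exists k, `[< online_choosable k >].
Proof. by exists #|G|; apply/asboolP; apply: online_choosable_card. Qed.

Definition online_choice_number : nat := ex_minn online_choosable_ex.

End Game.

(* K_{m*r}: r parts of m vertices each; (i, j) is the j-th vertex of part i. *)
Section CompleteMultipartite.
Variables m r : nat.

Definition multipartite_adj : rel ('I_r * 'I_m) := fun x y => x.1 != y.1.

Lemma multipartite_adj_sym : symmetric multipartite_adj.
Proof. by move=> x y; rewrite /multipartite_adj eq_sym. Qed.

Lemma multipartite_adj_irrefl : irreflexive multipartite_adj.
Proof. by move=> x; rewrite /multipartite_adj eqxx. Qed.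

Definition complete_multipartite : sgraph :=
  SGraph multipartite_adj_sym multipartite_adj_irrefl.

End CompleteMultipartite.

(* Main.v *)
Require Import Defs.
From mathcomp Require Import all_boot.
From mathcomp Require Import boolp.

(** In a complete multipartite graph Bob's answer lies in one part, and erasing
    fewer vertices never helps him, so against Alice only three answers have to
    be considered: erase everything presented in part 0, 1 or 2.  A winning
    strategy for Alice is then a finite ternary tree; an exhaustive search finds
    one with 214 moves, and its correctness is checked by computation. *)

Set Implicit Arguments.
Unset Strict Implicit.
Unset Printing Implicit Defensive.

(** Being inductive, a derivation is a finite winning tree for Alice. In [WinsExhausted] she wins by
    presenting [v] once more. Truncation in [f v - (v \in A)] matters only where [f v = 0], and
    there Alice has already won if [v] is left. *)
Inductive alice_wins (G : sgraph) : {set G} -> (G -> nat) -> Prop :=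
| WinsExhausted (R : {set G}) (f : G -> nat) v of v \in R & f v = 0 :
    alice_wins R f
| WinsPresent (R : {set G}) (f : G -> nat) (A : {set G})
    of A != set0 & A \subset R &
    (forall B : {set G}, B \subset A -> independent B ->
       alice_wins (R :\: B) (fun v => f v - (v \in A))) :
    alice_wins R f.

(** Alice repeats the same moves: extra vertices and smaller allowances cannot hurt her. *)
Lemma alice_wins_mono (G : sgraph) (R R' : {set G}) (f f' : G -> nat) :
  alice_wins R f -> R \subset R' -> {in R, forall v, f' v <= f v} ->
  alice_wins R' f'.
Proof.
move=> w; elim: w R' f' => {R f} [R f v vR fv0|R f A A0 AR _ IH] R' f' sRR' le_f.
  apply: (@WinsExhausted _ _ _ v); first exact: subsetP vR.
  by apply/eqP; rewrite -leqn0 -fv0 le_f.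
apply: (WinsPresent A0 (subset_trans AR sRR')) => B BA iB.
apply: (IH B BA iB); first exact: setSD.
by move=> v /setDP[vR _]; rewrite leq_sub2r ?le_f.
Qed.

(** Play the winning tree against Bob's fixed strategy. The invariant is that the current allowance
    [g v] is at least what [f v] leaves after the presentations in [h]. *)
Lemma alice_wins_not_choosable (G : sgraph) (f : G -> nat) :
  alice_wins [set: G] f -> ~ online_f_choosable f.
Proof.
move=> w [s [adm bnd]].
suff noplay R g : alice_wins R g -> forall h, legal s h -> remaining s h = R ->
    (forall v, f v <= presented h v + g v) -> False.
  by apply: (noplay _ _ w [::]).
elim=> {R g} [R g v vR gv0|R g A A0 AR _ IH] h lh hR le_f.
  (* One more presentation of the exhausted vertex exceeds its bound. *)
  have lvh : legal s ([set v] :: h).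
    by rewrite /= lh hR sub1set vR -card_gt0 cards1.
  have := bnd _ lvh v; rewrite /presented /= inE eqxx -/(presented h v).
  by rewrite leqNgt add1n ltnS; have := le_f v; rewrite gv0 addn0 => ->.
have lAh : legal s (A :: h) by rewrite /= lh A0 hR.
have [sA iA] := adm _ _ lAh.
apply: (IH _ sA iA _ lAh); first by rewrite /= hR.
move=> v; apply: leq_trans (le_f v) _.
rewrite /presented /= -/(presented h v).
by rewrite [_ + presented h v]addnC -addnA leq_add2l -leq_subLR.
Qed.

Lemma alice_wins_multipartite m r (R : {set complete_multipartite m r})
    (f : complete_multipartite m r -> nat) (A : {set complete_multipartite m r}) :
  A != set0 -> A \subset R ->
  (forall x, x \in A -> alice_wins (R :\: [set y in A | y.1 == x.1])
                                   (fun v => f v - (v \in A))) ->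
  alice_wins R f.
Proof.
move=> A0 AR w; apply: (WinsPresent A0 AR) => B BA iB.
have [x xA sBx] : exists2 x, x \in A & B \subset [set y in A | y.1 == x.1].
  (* An empty answer lies in every part, so any vertex of [A] serves. *)
  have [->|/set0Pn [x xB]] := eqVneq B set0.
    by have /set0Pn [x xA] := A0; exists x; rewrite ?sub0set.
  exists x; first exact: subsetP xB.
  apply/subsetP=> y yB; rewrite inE (subsetP BA _ yB) /=.
  by have := iB _ _ yB xB; rewrite /= /multipartite_adj negbK.
by apply: (alice_wins_mono (w x xA)) => //; apply: setDS.
Qed.

Section Certificate.

Local Notation K43 := (complete_multipartite 4 3).

(* [p i j] is one more than the number of times that the [j]-th vertex of part
   [i] may still be presented, and [0] if the vertex has been erased. *)
Definition position := nat -> nat -> nat.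

(* The numbers in [P a b c t u v] are bit masks of the columns that Alice
   presents in parts 0, 1 and 2; she continues with [t], [u] or [v] when Bob
   answers in part 0, 1 or 2 (the subtree is ignored if the mask is 0).  At
   [X] some vertex is left that may not be presented any more. *)
Inductive plan := X | P of nat & nat & nat & plan & plan & plan.

Fixpoint bit (m j : nat) : bool := if j is j'.+1 then bit m./2 j' else odd m.

Definition selection (a b c i : nat) : nat -> bool := bit (nth 0 [:: a; b; c] i).

Definition answer (A : nat -> nat -> bool) (k : nat) (p : position) : position :=
  fun i j => if A i j && (i == k) then 0 else p i j - A i j.

Definition has_vertex (q : nat -> nat -> bool) : bool :=
  has (fun i => has (q i) (iota 0 4)) (iota 0 3).

(** Masks may contain erased vertices, which stay at 0 under [answer]; hence the first conjunct asks
    for a vertex that is still live. *)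
Fixpoint check (t : plan) (p : position) : bool :=
  match t with
  | X => has_vertex (fun i j => p i j == 1)
  | P a b c t0 t1 t2 =>
    let A := selection a b c in
    [&& has_vertex (fun i j => A i j && (0 < p i j)),
        (a == 0) || check t0 (answer A 0 p),
        (b == 0) || check t1 (answer A 1 p)
      & (c == 0) || check t2 (answer A 2 p)]
  end.

Definition live (p : position) : {set K43} := [set x : K43 | 0 < p x.1 x.2].

Definition tokens (p : position) (x : K43) : nat := (p x.1 x.2).-1.

Lemma has_vertexP (q : nat -> nat -> bool) :
  has_vertex q -> exists x : K43, q x.1 x.2.
Proof.
case/hasP=> i; rewrite mem_iota => lti /hasP[j]; rewrite mem_iota => ltj qij.
by exists (Ordinal lti, Ordinal ltj).
Qed.

Lemma bit0 j : bit 0 j = false. Proof. by elim: j. Qed.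

Lemma answer_sound (A : nat -> nat -> bool) (p : position) :
  has_vertex (fun i j => A i j && (0 < p i j)) ->
  (forall x : K43, A x.1 x.2 ->
     alice_wins (live (answer A x.1 p)) (tokens (answer A x.1 p))) ->
  alice_wins (live p) (tokens p).
Proof.
move=> /has_vertexP[x Axp] w.
apply: (@alice_wins_multipartite _ _ _ _ [set y in live p | A y.1 y.2]).
- by apply/set0Pn; exists x; rewrite !inE andbC.
- by apply/subsetP=> y; rewrite inE => /andP[].
move=> y; rewrite 2!inE => /andP[py Ay].
(* Monotonicity is needed because a vertex at value 1 that is presented but not answered drops to 0
   in [answer], as if erased, although it remains in the game. This only disadvantages Alice. *)
apply: (alice_wins_mono (w y Ay)) => [|z]; last first.
  rewrite !inE /tokens /answer; case: ifP => // _.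
  by case: (A _ _); rewrite ?andbF ?andbT ?subn0 //; case: (p _ _) => //= n;
    rewrite !subn1.
apply/subsetP=> z; rewrite !inE /answer; case: ifP => // /negbT nA lt0.
rewrite (leq_trans lt0 (leq_subr _ _)) /= andbT.
by apply: contra nA => /andP[-> /eqP->] /=.
Qed.

Lemma check_sound t p : check t p -> alice_wins (live p) (tokens p).
Proof.
elim: t p => [|a b c t0 IH0 t1 IH1 t2 IH2] p.
  move=> /has_vertexP[x /eqP px].
  by apply: (@WinsExhausted _ _ _ x); rewrite ?inE /tokens px.
case/and4P=> hv c0 c1 c2; apply: (answer_sound hv) => -[[[|[|[|//]]] lti] j] /=.
(* With mask 0 nothing is presented in this part, so Bob cannot answer there. *)
- by case/orP: c0 => [/eqP->|/IH0 //]; rewrite /selection /= bit0.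
- by case/orP: c1 => [/eqP->|/IH1 //]; rewrite /selection /= bit0.
- by case/orP: c2 => [/eqP->|/IH2 //]; rewrite /selection /= bit0.
Qed.

Definition winning_plan : plan :=
  P 3 3 3 (P 4 5 5 (P 8 3 3 (P 0 1 1 X X X) (P 8 4 1 X X (P 8 4 2 (P 0 4 2 X
  X X) (P 8 0 2 X X X) (P 8 4 0 X X X))) (P 8 1 4 X (P 8 2 4 (P 0 2 4 X X X)
  (P 8 0 4 X X X) (P 8 2 0 X X X)) X)) (P 4 2 14 (P 8 2 9 (P 0 2 1 X X X)
  (P 8 8 1 X X (P 8 8 6 (P 0 8 2 X X (P 0 8 4 X X X)) (P 8 0 2 X X X)
  (P 8 8 8 (P 0 8 8 X X X) X X))) (P 8 2 6 X (P 8 0 2 X X (P 8 0 4 X X X))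
  X)) (P 4 8 9 (P 8 8 1 X X (P 8 8 6 (P 0 8 2 X X X) (P 8 0 2 X X (P 8 0 4 X
  X X)) (P 8 8 8 X (P 8 0 8 X X X) X))) (P 4 0 1 X X X) (P 4 8 6 (P 0 8 2 X
  X (P 0 8 4 X X X)) X X)) (P 4 2 1 (P 0 2 1 X X X) (P 4 0 1 X X X) (P 4 2 0
  X X X))) (P 4 14 2 (P 8 9 2 (P 0 1 2 X X X) (P 8 6 2 X X (P 8 2 0 X
  (P 8 4 0 X X X) X)) (P 8 1 8 X (P 8 6 8 (P 0 2 8 X (P 0 4 8 X X X) X)
  (P 8 8 8 (P 0 8 8 X X X) X X) (P 8 2 0 X X X)) X)) (P 4 1 2 (P 0 1 2 X X
  X) (P 4 0 2 X X X) (P 4 1 0 X X X)) (P 4 9 8 (P 8 1 8 X (P 8 6 8 (P 0 2 8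
  X X X) (P 8 8 8 X X (P 8 8 0 X X X)) (P 8 2 0 X (P 8 4 0 X X X) X)) X)
  (P 4 6 8 (P 0 2 8 X (P 0 4 8 X X X) X) X X) (P 4 1 0 X X X)))) (P 5 4 5
  (P 2 4 14 (P 8 4 9 (P 0 4 1 X X X) (P 8 8 1 X X (P 8 8 6 (P 0 8 2 X X
  (P 0 8 4 X X X)) (P 8 0 2 X X X) (P 8 8 8 (P 0 8 8 X X X) X X))) (P 8 4 6
  X (P 8 0 2 X X (P 8 0 4 X X X)) X)) (P 2 8 9 (P 8 8 1 X X (P 8 8 6
  (P 0 8 2 X X X) (P 8 0 2 X X (P 8 0 4 X X X)) (P 8 8 8 X (P 8 0 8 X X X)
  X))) (P 2 0 1 X X X) (P 2 8 6 (P 0 8 2 X X (P 0 8 4 X X X)) X X)) (P 2 4 1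
  (P 0 4 1 X X X) (P 2 0 1 X X X) (P 2 4 0 X X X))) (P 3 8 3 (P 4 8 1 X X
  (P 4 8 2 (P 0 8 2 X X X) (P 4 0 2 X X X) (P 4 8 0 X X X))) (P 1 0 1 X X X)
  (P 1 8 4 (P 2 8 4 (P 0 8 4 X X X) (P 2 0 4 X X X) (P 2 8 0 X X X)) X X))
  (P 14 4 2 (P 1 4 2 (P 0 4 2 X X X) (P 1 0 2 X X X) (P 1 4 0 X X X))
  (P 9 8 2 (P 6 8 2 X X (P 2 8 0 (P 4 8 0 X X X) X X)) (P 1 0 2 X X X)
  (P 1 8 8 (P 6 8 8 (P 8 8 8 X (P 8 0 8 X X X) X) (P 2 0 8 (P 4 0 8 X X X) X
  X) (P 2 8 0 X X X)) X X)) (P 9 4 8 (P 6 4 8 X (P 2 0 8 (P 4 0 8 X X X) X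
  X) X) (P 1 8 8 (P 6 8 8 (P 8 8 8 X X (P 8 8 0 X X X)) (P 2 0 8 X X X)
  (P 2 8 0 (P 4 8 0 X X X) X X)) X X) (P 1 4 0 X X X)))) (P 5 5 4 (P 2 14 4
  (P 8 9 4 (P 0 1 4 X X X) (P 8 6 4 X X (P 8 2 0 X (P 8 4 0 X X X) X))
  (P 8 1 8 X (P 8 6 8 (P 0 2 8 X (P 0 4 8 X X X) X) (P 8 8 8 (P 0 8 8 X X X)
  X X) (P 8 2 0 X X X)) X)) (P 2 1 4 (P 0 1 4 X X X) (P 2 0 4 X X X)
  (P 2 1 0 X X X)) (P 2 9 8 (P 8 1 8 X (P 8 6 8 (P 0 2 8 X X X) (P 8 8 8 X X
  (P 8 8 0 X X X)) (P 8 2 0 X (P 8 4 0 X X X) X)) X) (P 2 6 8 (P 0 2 8 X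
  (P 0 4 8 X X X) X) X X) (P 2 1 0 X X X))) (P 14 2 4 (P 1 2 4 (P 0 2 4 X X
  X) (P 1 0 4 X X X) (P 1 2 0 X X X)) (P 9 8 4 (P 6 8 4 X X (P 2 8 0
  (P 4 8 0 X X X) X X)) (P 1 0 4 X X X) (P 1 8 8 (P 6 8 8 (P 8 8 8 X
  (P 8 0 8 X X X) X) (P 2 0 8 (P 4 0 8 X X X) X X) (P 2 8 0 X X X)) X X))
  (P 9 2 8 (P 6 2 8 X (P 2 0 8 (P 4 0 8 X X X) X X) X) (P 1 8 8 (P 6 8 8
  (P 8 8 8 X X (P 8 8 0 X X X)) (P 2 0 8 X X X) (P 2 8 0 (P 4 8 0 X X X) X
  X)) X X) (P 1 2 0 X X X))) (P 3 3 8 (P 4 1 8 X (P 4 2 8 (P 0 2 8 X X X)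
  (P 4 0 8 X X X) (P 4 2 0 X X X)) X) (P 1 4 8 (P 2 4 8 (P 0 4 8 X X X)
  (P 2 0 8 X X X) (P 2 4 0 X X X)) X X) (P 1 1 0 X X X))).

(** The value 5 encodes four allowed presentations per vertex. *)
Lemma winning_plan_check : check winning_plan (fun _ _ => 5).
Proof. by vm_compute. Qed.

End Certificate.

Theorem theorem4p1 : 5 <= online_choice_number (complete_multipartite 4 3).
Proof.
rewrite /online_choice_number; case: ex_minnP => k /asboolP chk _.
rewrite leqNgt; apply/negP=> ltk5; move: chk.
apply: alice_wins_not_choosable.
(* The plan is for allowance 4; monotonicity covers every [k] below 5. *)
by apply: (alice_wins_mono (check_sound winning_plan_check)).
Qed.
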